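(* Let $N\ge 1$. For every real symmetric positive definite $N\times N$ matrix $S$, $$\max\left\{\rho(A) :\ (A,D)\in\mathcal I(S)\right\} = \max\sigma(S).$$ (In particular the maximum is attained.)
   Context: Notation. $\mathcal M_N(\mathbb R)$ is the set of real $N\times N$ matrices; $\mathcal S_N^{>0}(\mathbb R)$ (resp. $\mathcal S_N^{\ge 0}(\mathbb R)$) is the set of symmetric positive definite (resp. symmetric positive semi-definite) real $N\times N$ matrices. $\sigma(M)$ is the spectrum of a matrix $M$ (set of its complex eigenvalues), $\mathrm{Tr}$ is the trace, and $\Re$ is the real part. For $A\in\mathcal M_N(\mathbb R)$, $$\rho(A)=\inf\{-\Re(\lambda):\ \lambda\in\sigma(A)\}.$$ For $S\in\mathcal S_N^{>0}(\mathbb R)$ let $$\psi_\infty(x)=\frac{(\det S)^{1/2}}{(2\pi)^{N/2}}\exp\left(-\frac{x^TSx}{2}\right),\qquad x\in\mathbb R^N,$$ the density of the centered Gaussian distribution with covariance matrix $S^{-1}$. For $A\in\mathcal M_N(\mathbb R)$ and $D\in\mathcal S_N^{\ge 0}(\mathbb R)$, the generalized Ornstein-Uhlenbeck generator with drift matrix $A$ and diffusion matrix $D$ is $$L_{A,D}f(x)=(Ax)^T\nabla f(x)+\nabla\cdot(D\nabla f)(x),$$ and its dual in the Lebesgue sense is $$L'_{A,D}f(x)=-(Ax)^T\nabla f(x)-\mathrm{Tr}(A)f(x)+\nabla\cdot(D\nabla f)(x).$$ Finally, $$\mathcal I(S)=\left\{(A,D)\in\mathcal M_N(\mathbb R)\times\mathcal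 S_N^{\ge 0}(\mathbb R):\ \mathrm{Tr}\,D\le N,\ L'_{A,D}\psi_\infty=0\right\}.$$ *)

(* Defs.v *)
From HB Require Import structures.
From mathcomp Require Import all_boot all_order all_algebra sesquilinear.
From mathcomp Require Import complex.
From mathcomp Require Import all_classical all_reals all_analysis.

Set Implicit Arguments.
Unset Strict Implicit.
Unset Printing Implicit Defensive.

Import Order.TTheory GRing.Theory Num.Theory.
Import numFieldNormedType.Exports.

Local Open Scope classical_set_scope.
Local Open Scope ring_scope.
Local Open Scope complex_scope.

(* On [R[i]] the order is the partial one: x <= y iff Im x = Im y and
   Re x <= Re y. Hence [is_max E m%:C] also entails that E consists of reals. *)
Definition is_max d (T : porderType d) (E : set T) (m : T) : Prop :=
  E m /\ ubound E m.

Section Matrices.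
Context {R : realType} {N : nat}.

Definition quad_form (M : 'M[R]_N) (x : 'cV[R]_N) : R := (x^T *m M *m x) 0 0.

Definition sym_posdef (S : 'M[R]_N) : Prop :=
  S \is symmetricmx /\ forall x : 'cV[R]_N, x != 0 -> 0 < quad_form S x.

Definition sym_possemidef (D : 'M[R]_N) : Prop :=
  D \is symmetricmx /\ forall x : 'cV[R]_N, 0 <= quad_form D x.

Definition spectrum (M : 'M[R]_N) : set R[i] :=
  [set l | eigenvalue (map_mx (real_complex R) M) l].

(* [inf] is the infimum in [R]; the spectrum is finite, and nonempty for
   [0 < N], so that it is a genuine infimum in that case. *)
Definition rho (A : 'M[R]_N) : R :=
  inf [set - complex.Re l | l in spectrum A].

End Matrices.

Section DifferentialOperators.
Context {R : realType} {N : nat}.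
Implicit Types (f : 'cV[R]_N -> R) (F : 'cV[R]_N -> 'cV[R]_N) (x : 'cV[R]_N).

Definition partial (i : 'I_N) f x : R := 'D_(delta_mx i 0) f x.

Definition grad f x : 'cV[R]_N := \col_i partial i f x.

Definition divergence F x : R :=
  \sum_(i < N) partial i (fun y => F y i 0) x.

Definition OU_dual (A D : 'M[R]_N) f x : R :=
  - ((A *m x)^T *m grad f x) 0 0 - \tr A * f x
  + divergence (fun y => D *m grad f y) x.

Definition psi_infty (S : 'M[R]_N) x : R :=
  Num.sqrt (\det S) / (2 * pi) `^ (N%:R / 2) * expR (- (quad_form S x / 2)).

Definition admissible (S : 'M[R]_N) : set ('M[R]_N * 'M[R]_N) :=
  [set AD | [/\ sym_possemidef AD.2,
                \tr AD.2 <= N%:R &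
                forall x, OU_dual AD.1 AD.2 (psi_infty S) x = 0]].

End DifferentialOperators.

(* Main.v *)
Require Import Defs.
From mathcomp Require Import all_boot all_order all_algebra.
From mathcomp Require Import sesquilinear complex.
From mathcomp Require Import all_classical all_reals all_analysis.
From mathcomp Require Import ring lra.

(** Write [psi] for [psi_infty S]. Differentiating the Gaussian gives
    [[
      OU_dual A D psi x =
        psi x * ((A x)^T S x - tr A - tr (D S) + (S x)^T D (S x))
    ]]
    ([OU_dual_psi]), so that the two inequalities become linear algebra. Let
    [s] be the largest eigenvalue of [S].

    Upper bound. At [x = 0] the identity gives [- tr A = tr (D S)], since
    [psi 0 > 0]. The trace of [A] is the sum of its complex eigenvalues, hence
    [N * rho A <= - tr A = tr (D S) <= s * tr D <= s * N]; the second
    inequality is seen in an orthonormal eigenbasis of [S], where the diagonal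
    entries of [D] are nonnegative.

    Attainment. For [J] antisymmetric, [(- (D + J) S, D)] satisfies the
    equation ([OU_dual_skew]). Choose [P] with [P^T S P = 1] such that the sum
    [u] of the columns of [P] satisfies [s * |u|^2 = N]
    ([congr_to1_sum_columns]). Take [D = s u u^T = P (s E) P^T], where [E] is
    the all-ones matrix, so that [tr D = N], and [J = P (s K) P^T], where [K]
    is the sign matrix, with [1] below the diagonal and [-1] above it. Then
    [- (D + J) S = P (- s (E + K)) P^-1], and [E + K] is triangular with ones
    on the diagonal: the only eigenvalue of the drift is [- s].

    To obtain [P], diagonalise [S = Q diag(d) Q^T] over the reals and compose
    [Q diag(1 / sqrt d)] with the Householder reflection that maps the all-ones
    vector to [sqrt N] times the basis vector of a largest [d_k]. The same
    reflections yield the real spectral theorem by induction on the size. *)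

Set Implicit Arguments.
Unset Strict Implicit.
Unset Printing Implicit Defensive.

Import Order.TTheory GRing.Theory Num.Theory.

Local Open Scope classical_set_scope.
Local Open Scope ring_scope.
Local Open Scope complex_scope.

(** * Reflections and the real spectral theorem *)

Lemma symmetricmxP (R : fieldType) n (M : 'M[R]_n) :
  reflect (M^T = M) (M \is symmetricmx).
Proof.
by rewrite qualifE /= expr0 scale1r map_mx_id // eq_sym; exact: eqP.
Qed.

Lemma mx11_mulr (R : comPzRingType) m (w : 'cV[R]_m) (M : 'M[R]_1) :
  w *m M = M 0 0 *: w.
Proof. by rewrite [M]mx11_scalar mul_mx_scalar mxE eqxx mulr1n. Qed.

Lemma normsq_eq0 (R : realDomainType) n (w : 'cV[R]_n) :
  ((w^T *m w) 0 0 == 0) = (w == 0).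
Proof.
apply/eqP/eqP => [|->]; last by rewrite mulmx0 mxE.
rewrite mxE => /eqP; rewrite psumr_eq0 => [/allP h|i _]; last first.
  by rewrite mxE -expr2 sqr_ge0.
apply/colP => i; have := h i (mem_index_enum _).
by rewrite !mxE -expr2 sqrf_eq0 => /eqP.
Qed.

Lemma normsq_ge0 (R : realDomainType) n (w : 'cV[R]_n) :
  0 <= (w^T *m w) 0 0.
Proof. by rewrite mxE sumr_ge0 // => i _; rewrite mxE -expr2 sqr_ge0. Qed.

Lemma tr_dot (R : comPzRingType) n (x y : 'cV[R]_n) :
  (x^T *m y) 0 0 = (y^T *m x) 0 0.
Proof. by rewrite !mxE; apply: eq_bigr => i _; rewrite !mxE mulrC. Qed.

(** Two vectors of equal length are exchanged by an orthogonal reflection,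
    namely the one along [x - y]. *)
Lemma householder (R : realFieldType) n (x y : 'cV[R]_n) :
  (x^T *m x) 0 0 = (y^T *m y) 0 0 ->
  exists H : 'M[R]_n, [/\ H^T = H, H *m H = 1%:M & H *m x = y].
Proof.
move=> xy; pose w := x - y; pose a := (w^T *m w) 0 0.
pose c := 2 / a; pose W := w *m w^T.
have WW : W *m W = a *: W.
  by rewrite /W mulmxA -(mulmxA w) mx11_mulr -scalemxAl.
exists (1%:M - c *: W); split.
- by rewrite linearB /= linearZ /= trmx1 /W trmx_mul trmxK.
- rewrite mulmxBl mul1mx mulmxBr mulmx1 -scalemxAl -scalemxAr WW !scalerA.
  (* For w = 0 one has c = 2 / 0 = 0, and both sides vanish. *)
  have -> : c * c * a = 2 * c.
    rewrite /c; have [->|a0] := eqVneq a 0; first by rewrite invr0 !mulr0.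
    by field.
  by rewrite mulr_natl mulr2n scalerDl opprB addrK subrK.
- rewrite mulmxBl mul1mx -scalemxAl /W -mulmxA mx11_mulr scalerA.
  have [a0|a0] := eqVneq a 0.
    have w0 : w = 0 by apply/eqP; rewrite -normsq_eq0; apply/eqP.
    by rewrite w0 scaler0 subr0; apply/subr0_eq.
  (* Since x and y have the same length, |x - y|^2 = 2 (x - y)^T x. *)
  have aE : a = 2 * (w^T *m x) 0 0.
    rewrite /a {2}/w mulmxBr mxE [X in _ + X]mxE.
    rewrite /w linearB /= !mulmxBl !mxE.
    have := xy; have := tr_dot x y; rewrite !mxE => -> ->.
    by ring.
  have -> : c * (w^T *m x) 0 0 = 1.
    rewrite /c; move: a0; rewrite aE => a0; field.
    by move: a0; rewrite mulf_eq0 negb_or => /andP[_].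
  by rewrite scale1r /w opprB addrC subrK.
Qed.

(** A complex eigenvector of [S] has real and imaginary parts [p] and [q]
    spanning an [S]-stable real space; evaluating [p S q^T] in two ways shows
    that the eigenvalue is real, so that [p] and [q] both lie in its
    eigenspace. *)
Lemma sym_eigenvector (R : rcfType) n (S : 'M[R]_n.+1) : S^T = S ->
  exists (l : R) (v : 'cV[R]_n.+1), v != 0 /\ S *m v = l *: v.
Proof.
move=> Ssym; pose S' := map_mx (real_complex R) S.
have [z] : exists z, root (char_poly S') z.
  by apply/closed_rootP; rewrite size_char_poly.
rewrite -eigenvalue_root_char => /eigenvalueP[v vS v0].
pose p := map_mx (@complex.Re R) v; pose q := map_mx (@complex.Im R) v.
have pS : p *m S = complex.Re z *: p - complex.Im z *: q.
  apply/rowP => i; have /(congr1 (@complex.Re R)) := (matrixP _ _).2 vS 0 i.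
  rewrite !mxE; case: z {vS} => a b; case: (v 0 i) => c d /= <-.
  rewrite raddf_sum; apply: eq_bigr => j _; rewrite !mxE.
  by case: (v 0 j) => e f /=; rewrite mulr0 subr0.
have qS : q *m S = complex.Re z *: q + complex.Im z *: p.
  apply/rowP => i; have /(congr1 (@complex.Im R)) := (matrixP _ _).2 vS 0 i.
  rewrite !mxE; case: z {vS pS} => a b; case: (v 0 i) => c d /= <-.
  rewrite raddf_sum; apply: eq_bigr => j _; rewrite !mxE.
  by case: (v 0 j) => e f /=; rewrite mulr0 add0r.
have tr11 (M : 'M[R]_1) : M 0 0 = M^T 0 0 by rewrite mxE.
have pSq : (p *m S *m q^T) 0 0 = (q *m S *m p^T) 0 0.
  by rewrite [RHS]tr11 !trmx_mul trmxK Ssym mulmxA.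
have dotC : (p *m q^T) 0 0 = (q *m p^T) 0 0.
  by rewrite [RHS]tr11 trmx_mul trmxK.
have pq0 : p^T != 0 \/ q^T != 0.
  rewrite -[0]trmx0 !(inj_eq trmx_inj).
  have [p0|] := eqVneq p 0; last by left.
  right; apply: contra_neq v0 => q0; apply/rowP => i; rewrite mxE.
  have := (matrixP _ _).2 p0 0 i; have := (matrixP _ _).2 q0 0 i.
  by rewrite !mxE; case: (v 0 i) => c d /= -> ->.
have z0 : complex.Im z = 0.
  move: pSq; rewrite pS qS mulmxBl mulmxDl -!scalemxAl !mxE.
  have := dotC; rewrite !mxE => ->.
  move=> /eqP; rewrite -subr_eq0 opprD addrACA [X in X + _]subrr add0r -opprD.
  rewrite oppr_eq0 -mulrDr mulf_eq0 => /orP[/eqP//|].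
  have pE := normsq_ge0 p^T; have qE := normsq_ge0 q^T.
  have p0 := normsq_eq0 p^T; have q0 := normsq_eq0 q^T.
  move: pE qE p0 q0; rewrite !trmxK !mxE => pE qE p0 q0.
  by rewrite addrC paddr_eq0 // p0 q0; case: pq0 => /negPf ->; rewrite ?andbF.
move: pS qS; rewrite z0 !scale0r subr0 addr0.
move=> /(congr1 trmx) + /(congr1 trmx); rewrite !trmx_mul Ssym !linearZ /=.
by case: pq0 => ? ? ?; exists (complex.Re z); [exists p^T|exists q^T].
Qed.

(** The spectral theorem for real symmetric matrices. *)
Lemma real_spectral (R : rcfType) n (S : 'M[R]_n) : S^T = S ->
  exists (Q : 'M[R]_n) (d : 'rV[R]_n),
    Q^T *m Q = 1%:M /\ S = Q *m diag_mx d *m Q^T.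
Proof.
elim: n S => [S Ssym|n IHn].
  by exists 1%:M, 0; split; apply/matrixP => -[].
rewrite -[n.+1]/(1 + n)%N => S Ssym.
have [l [u [u0 Su]]] : exists (l : R) (u : 'cV[R]_(1 + n)),
    u != 0 /\ S *m u = l *: u := sym_eigenvector Ssym.
have a0 : 0 < (u^T *m u) 0 0 by rewrite lt_def normsq_eq0 u0 normsq_ge0.
pose v := (Num.sqrt ((u^T *m u) 0 0))^-1 *: u.
have Sv : S *m v = l *: v by rewrite -scalemxAr Su scalerA mulrC -scalerA.
pose e : 'cV[R]_(1 + n) := delta_mx 0 0.
have vv : (e^T *m e) 0 0 = (v^T *m v) 0 0.
  rewrite /e /v trmx_delta mul_delta_mx mxE eqxx.
  rewrite -scalemxAr linearZ /= -scalemxAl.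
  rewrite scalerA mxE -expr2 exprVn sqr_sqrtr ?ltW // mulVf //.
  exact: lt0r_neq0.
have [H [Hsym HH He]] := householder vv.
pose M : 'M[R]_(1 + n) := H *m S *m H.
have M0 : M *m e = l *: e.
  by rewrite -mulmxA He -mulmxA Sv -scalemxAr -He mulmxA HH mul1mx.
have Msym : M^T = M by rewrite /M !trmx_mul Hsym Ssym mulmxA.
have HH' : H *m M *m H = S.
  by rewrite /M !mulmxA HH mul1mx -mulmxA HH mulmx1.
clearbody M.
have Mi0 (i j : 'I_(1 + n)) : j = 0%N :> nat -> M i j = l * (i == j)%:R.
  move=> j0; have -> : j = 0 :> 'I_n.+1 by apply: val_inj.
  have := (matrixP _ _).2 M0 i 0.
  by rewrite -colE !mxE eqxx andbT.
have [Q' [d' [QQ' dE']]] : exists (Q : 'M[R]_n) (d : 'rV[R]_n),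
    Q^T *m Q = 1%:M /\ drsubmx M = Q *m diag_mx d *m Q^T.
  by apply: IHn; rewrite trmx_drsub Msym.
have ME : M = block_mx l%:M 0 0 (drsubmx M).
  rewrite -{1}(submxK M); congr block_mx; apply/matrixP => i j; rewrite !mxE.
  - by rewrite !ord1 Mi0 // eqxx mulr1 mulr1n.
  - by rewrite !ord1 -Msym mxE Mi0 // eq_rlshift mulr0.
  - by rewrite !ord1 Mi0 // eq_rlshift mulr0.
(* H moves v to the first axis, and B diagonalises the remaining block. *)
pose B : 'M[R]_(1 + n) := block_mx 1%:M 0 0 Q'.
have Bt : B^T = block_mx 1%:M 0 0 Q'^T by rewrite tr_block_mx !trmx0 trmx1.
exists (H *m B), (row_mx l%:M d'); split.
  rewrite trmx_mul Hsym mulmxA -(mulmxA _ H H) HH mulmx1 Bt mulmx_block.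
  by rewrite !mulmx0 !mul0mx !addr0 !add0r mulmx1 QQ' -scalar_mx_block.
rewrite trmx_mul Hsym !mulmxA -HH' ; congr (_ *m _).
rewrite -!mulmxA; congr (_ *m _).
rewrite ME dE' diag_mx_row Bt !mulmx_block.
rewrite !mulmx0 !mul0mx !addr0 !add0r mul1mx mulmx1 mulmxA.
congr block_mx; rewrite ?mulmx0 //.
by apply/matrixP => i j; rewrite !ord1 !mxE eqxx !mulr1n.
Qed.

(** * Spectrum and trace *)

Lemma char_poly_similar (R : comNzRingType) n (P T Q : 'M[R]_n) :
  Q *m P = 1%:M -> char_poly (P *m T *m Q) = char_poly T.
Proof.
move=> QP; have PQ : P *m Q = 1%:M by apply: mulmx1C.
have PQX : map_mx polyC P *m map_mx polyC Q = 1%:M.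
  by rewrite -map_mxM PQ map_mx1.
rewrite /char_poly; have -> : char_poly_mx (P *m T *m Q) =
    map_mx polyC P *m char_poly_mx T *m map_mx polyC Q.
  rewrite /char_poly_mx mulmxBr mulmxBl !map_mxM mul_mx_scalar -scalemxAl.
  by rewrite PQX scalemx1.
by rewrite !det_mulmx mulrAC -det_mulmx PQX det1 mul1r.
Qed.

(** [Q] is the inverse of [P]: the spectrum of a matrix similar to a
    triangular one is read off the diagonal. *)
Lemma spectrum_trig (R : realType) n (P T Q : 'M[R]_n) :
  Q *m P = 1%:M -> is_trig_mx T ->
  spectrum (P *m T *m Q) = [set (T i i)%:C | i in [set: 'I_n]].
Proof.
move=> QP Ttrig; apply/seteqP; rewrite /spectrum.
suff E l : eigenvalue (map_mx (real_complex R) (P *m T *m Q)) l =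
    [exists i, l == (T i i)%:C].
  split=> [l /=|l [i _ <-] /=]; rewrite E.
    by move=> /existsP[i /eqP ->]; exists i.
  by apply/existsP; exists i.
rewrite eigenvalue_root_char -map_char_poly char_poly_similar //.
rewrite char_poly_trig //.
rewrite rmorph_prod rootE horner_prod prodf_seq_eq0.
apply/hasP/existsP => [[i _]|[ i ]].
  by rewrite /= map_polyXsubC hornerXsubC subr_eq0 => ?; exists i.
move=> ?; exists i; rewrite ?mem_index_enum //=.
by rewrite map_polyXsubC hornerXsubC subr_eq0.
Qed.

Lemma rho_spectrum1 (R : realType) n (A : 'M[R]_n) (s : R) :
  spectrum A = [set (- s)%:C] -> rho A = s.
Proof. by move=> h; rewrite /rho h image_set1 /= opprK inf1. Qed.

(** The trace is the sum of the complex eigenvalues, and [- Re] of each of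
    them is at least [rho A]. *)
Lemma rho_le_trace (R : realType) n (A : 'M[R]_n) : (0 < n)%N ->
  rho A * n%:R <= - \tr A.
Proof.
move=> n0; pose A' := map_mx (real_complex R) A.
have [rs] := closed_field_poly_normal (char_poly A').
rewrite (monicP (char_poly_monic _)) scale1r => rsE.
have size_rs : size rs = n.
  by have := size_char_poly A'; rewrite rsE size_prod_XsubC => -[].
have sum_rs : \sum_(r <- rs) r = (\tr A)%:C.
  apply: oppr_inj; rewrite -coefPn_prod_XsubC ?size_rs -?lt0n //.
  by rewrite -rsE char_poly_trace // trace_map_mx.
have spE l : spectrum A l <-> l \in rs.
  by rewrite /spectrum /= eigenvalue_root_char -root_prod_XsubC -rsE.
have -> : \tr A = \sum_(r <- rs) complex.Re r.
  by have := congr1 (@complex.Re R) sum_rs; rewrite raddf_sum /= => <-.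
have lb : has_lbound [set - complex.Re l | l in spectrum A].
  exists (- \sum_(r <- rs) `|complex.Re r|) => _ [l /spE lrs <-].
  rewrite lerN2 (big_rem _ lrs) /= (le_trans (ler_norm _)) // lerDl.
  exact: sumr_ge0.
rewrite -sumrN mulr_natr -[X in _ *+ X]size_rs -sum1_size -sumrMnr.
rewrite big_seq [leRHS]big_seq.
apply: ler_sum => r rrs; rewrite mulr1n; apply: ge_inf => //.
by exists r => //; apply/spE.
Qed.

(** * The dual operator on a Gaussian *)

Lemma derive_line (R : realType) (V W : normedModType R) (f : V -> W) a v :
  'D_v f a = 'D_1 (fun h : R => f (h *: v + a)) 0.
Proof.
rewrite /derive; set F := (X in lim (X @ _)); set G := (X in _ = lim (X @ _)).
suff -> : F = G by [].
apply/funext => h; rewrite /F /G /= scale0r add0r addr0.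
by congr (_ *: (f (_ *: v + a) - _)); exact: (esym (mulr1 h)).
Qed.

(** The restriction to a line of an affine function times a Gaussian,
    differentiated at the origin of the line. *)
Lemma derive_affine_gauss (R : realType) (al be a b d k : R) :
  'D_1 (fun h : R => (al + h * be) *
     (k * expR (- ((a + h * b + h ^+ 2 * d) / 2)))) 0 =
  (be - al * (b / 2)) * (k * expR (- (a / 2))).
Proof.
pose q : R -> R := - (cst 2^-1 * (cst a + cst b * id + cst d * (id * id))).
have -> : (fun h : R => (al + h * be) *
     (k * expR (- ((a + h * b + h ^+ 2 * d) / 2)))) =
   ((cst al + cst be * id) * (cst k * (expR \o q)) : R -> R).
  apply/funext => h; rewrite /q !fctE /= /GRing.scale /=.
  by rewrite (mulrC be) (mulrC b) (mulrC d) (mulrC _ 2^-1).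
have dq : is_derive (0 : R) 1 q (- (b / 2)).
  apply: is_derive_eq.
  by rewrite /GRing.scale /=; ring.
have de : is_derive (0 : R) 1 (expR \o q) (expR (q 0) * - (b / 2)).
  exact: is_derive1_comp.
apply: derive_val.
apply: is_derive_eq.
have q0 : q 0 = - (a / 2) by rewrite /q !fctE /=; ring.
rewrite !fctE /= q0 /GRing.scale /=; ring.
Qed.

Lemma quad_form_line (R : realType) n (S : 'M[R]_n) (x : 'cV[R]_n) i (h : R) :
  S^T = S ->
  quad_form S (h *: delta_mx i 0 + x) =
  quad_form S x + h * (2 * (S *m x) i 0) + h ^+ 2 * S i i.
Proof.
move=> Ssym; rewrite /quad_form [(_ + _)^T]linearD /= [(_ *: _)^T]linearZ /=.
rewrite trmx_delta.
rewrite !mulmxDl !mulmxDr -!scalemxAl -!scalemxAr.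
have E1 :
    ((delta_mx 0 i : 'rV[R]_n) *m S *m (delta_mx i 0 : 'cV[R]_n)) 0 0 = S i i.
  by rewrite -rowE -colE !mxE.
have E2 : ((delta_mx 0 i : 'rV[R]_n) *m S *m x) 0 0 = (S *m x) i 0.
  by rewrite -mulmxA -rowE mxE.
have E3 : (x^T *m S *m (delta_mx i 0 : 'cV[R]_n)) 0 0 = (S *m x) i 0.
  by rewrite -colE mxE -{1}Ssym -trmx_mul mxE.
have addE (M1 M2 : 'M[R]_1) : (M1 + M2) 0 0 = M1 0 0 + M2 0 0 by rewrite mxE.
have scaleE (c : R) (M1 : 'M[R]_1) : (c *: M1) 0 0 = c * M1 0 0 by rewrite mxE.
by rewrite !(addE, scaleE) E1 E2 E3; ring.
Qed.

(** Each component of [D *m grad psi] is a linear form times [psi], so this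
    product rule computes its divergence. *)
Lemma partial_linear_psi (R : realType) n (S : 'M[R]_n) (u : 'cV[R]_n)
    (x : 'cV[R]_n) i : S^T = S ->
  partial i (fun y => (u^T *m y) 0 0 * psi_infty S y) x =
  (u i 0 - (u^T *m x) 0 0 * (S *m x) i 0) * psi_infty S x.
Proof.
move=> Ssym; rewrite /partial derive_line /psi_infty.
have -> : (fun h : R => (u^T *m (h *: delta_mx i 0 + x)) 0 0 *
    (Num.sqrt (\det S) / (2 * pi) `^ (n%:R / 2) *
     expR (- (quad_form S (h *: delta_mx i 0 + x) / 2)))) =
  (fun h => ((u^T *m x) 0 0 + h * u i 0) *
    (Num.sqrt (\det S) / (2 * pi) `^ (n%:R / 2) *
     expR (- ((quad_form S x + h * (2 * (S *m x) i 0)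
               + h ^+ 2 * S i i) / 2)))).
  apply/funext => h; rewrite quad_form_line //; congr (_ * _).
  rewrite mulmxDr -scalemxAr -colE addrC mxE [X in _ + X]mxE.
  by rewrite ![col _ _ _ _]mxE ![_^T _ _]mxE.
by rewrite derive_affine_gauss; congr (_ * _); field.
Qed.

Lemma grad_psi (R : realType) n (S : 'M[R]_n) (x : 'cV[R]_n) : S^T = S ->
  grad (psi_infty S) x = - psi_infty S x *: (S *m x).
Proof.
move=> Ssym; apply/colP => i; rewrite mxE [RHS]mxE /partial derive_line.
rewrite /psi_infty; set k := Num.sqrt _ / _.
have -> : (fun h : R => k * expR (- (quad_form S (h *: delta_mx i 0 + x) / 2)))
  = (fun h => (1 + h * 0) *
    (k * expR (- ((quad_form S x + h * (2 * (S *m x) i 0)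
                   + h ^+ 2 * S i i) / 2)))).
  by apply/funext => h; rewrite quad_form_line // mulr0 addr0 mul1r.
by rewrite derive_affine_gauss; field.
Qed.

Lemma OU_dual_psi (R : realType) n (A D S : 'M[R]_n) (x : 'cV[R]_n) :
  S^T = S ->
  OU_dual A D (psi_infty S) x =
  psi_infty S x * (((A *m x)^T *m (S *m x)) 0 0 - \tr A - \tr (D *m S)
                   + quad_form D (S *m x)).
Proof.
move=> Ssym; rewrite /OU_dual.
have -> : divergence (fun y => D *m grad (psi_infty S) y) x =
    psi_infty S x * (quad_form D (S *m x) - \tr (D *m S)).
  rewrite /divergence.
  under eq_bigr => i _.
    have -> : (fun y => (D *m grad (psi_infty S) y) i 0) =
        (fun y => ((- row i (D *m S))^T^T *m y) 0 0 * psi_infty S y).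
      apply/funext => y; rewrite trmxK grad_psi // -scalemxAr mulmxA.
      rewrite mulNmx -row_mul [LHS]mxE [X in _ = X * _]mxE [row _ _ _ _]mxE.
      by ring.
    rewrite partial_linear_psi // trmxK mulNmx -row_mul !mxE.
    over.
  rewrite -mulr_suml mulrC; congr (_ * _).
  rewrite big_split /= sumrN addrC; congr (_ - _).
  rewrite /quad_form -mulmxA mxE; apply: eq_bigr => i _.
    rewrite !mxE; have := (matrixP _ _).2 (mulmxA D S x) i 0.
    by rewrite !mxE => ->; ring.
  by apply: eq_bigr => i _; rewrite mxE.
rewrite grad_psi // -scalemxAr mxE; ring.
Qed.

Lemma skew_quad_form0 (R : realType) n (J : 'M[R]_n) (y : 'cV[R]_n) :
  J^T = - J -> quad_form J y = 0.
Proof.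
move=> Jskew; have : quad_form J y = - quad_form J y.
  rewrite {1}/quad_form -[in LHS](trmxK (y^T *m J *m y)) mxE.
  by rewrite !trmx_mul trmxK Jskew mulNmx mulmxN mulmxA mxE.
by lra.
Qed.

Lemma tr_skew_sym0 (R : realType) n (J S : 'M[R]_n) :
  J^T = - J -> S^T = S -> \tr (J *m S) = 0.
Proof.
move=> Jskew Ssym; have : \tr (J *m S) = - \tr (J *m S).
  by rewrite -{1}mxtrace_tr trmx_mul Jskew Ssym mulmxN linearN /= mxtrace_mulC.
by lra.
Qed.

(** An antisymmetric perturbation [J] of the reversible drift [- D S] leaves
    the Gaussian invariant: it contributes neither to the quadratic form nor to
    the trace. *)
Lemma OU_dual_skew (R : realType) n (D J S : 'M[R]_n) (x : 'cV[R]_n) :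
  D^T = D -> J^T = - J -> S^T = S ->
  OU_dual (- ((D + J) *m S)) D (psi_infty S) x = 0.
Proof.
move=> Dsym Jskew Ssym; rewrite OU_dual_psi //.
have -> : ((- ((D + J) *m S) *m x)^T *m (S *m x)) 0 0 =
    - quad_form D (S *m x) + quad_form J (S *m x).
  rewrite mulNmx -mulmxA linearN /= trmx_mul linearD /= Dsym Jskew.
  by rewrite mulNmx mulmxBr mulmxBl opprB addrC mxE [X in X + _]mxE.
rewrite linearN /= mulmxDl linearD /= (tr_skew_sym0 Jskew) //.
rewrite (skew_quad_form0 _ Jskew).
by ring.
Qed.

(** * The upper bound *)

Lemma tr_mul_diag (R : comPzRingType) n (M : 'M[R]_n) (d : 'rV[R]_n) :
  \tr (M *m diag_mx d) = \sum_i M i i * d 0 i.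
Proof. by apply: eq_bigr => i _; rewrite mul_mx_diag mxE. Qed.

Lemma quad_form_col (R : realType) n (M Q : 'M[R]_n) i :
  (Q^T *m M *m Q) i i = quad_form M (col i Q).
Proof.
by rewrite /quad_form tr_col colE rowE !mulmxA -colE -!mulmxA -rowE !mxE.
Qed.

(** [d_i] is the value of the quadratic form at the [i]-th column of [Q]. *)
Lemma posdef_diag_gt0 (R : realType) n (S Q : 'M[R]_n) (d : 'rV[R]_n) i :
  sym_posdef S -> Q^T *m Q = 1%:M -> S = Q *m diag_mx d *m Q^T -> 0 < d 0 i.
Proof.
move=> [_ Spos] QQ SE.
have -> : d 0 i = (Q^T *m S *m Q) i i.
  rewrite SE !mulmxA QQ mul1mx -mulmxA QQ mulmx1.
  by rewrite mxE eqxx mulr1n.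
rewrite quad_form_col; apply: Spos; apply/eqP => Q0.
have /eqP := (matrixP _ _).2 QQ i i; rewrite [1%:M _ _]mxE eqxx.
have -> : (Q^T *m Q) i i = ((col i Q)^T *m col i Q) 0 0.
  by rewrite !mxE; apply: eq_bigr => j _; rewrite !mxE.
by rewrite Q0 mulmx0 mxE eq_sym oner_eq0.
Qed.

Lemma psi_infty_gt0 (R : realType) n (S : 'M[R]_n) (x : 'cV[R]_n) :
  sym_posdef S -> 0 < psi_infty S x.
Proof.
move=> hS; have [Q [d [QQ SE]]] := real_spectral (symmetricmxP _ hS.1).
rewrite /psi_infty mulr_gt0 ?expR_gt0 //.
rewrite divr_gt0 ?powR_gt0 ?mulr_gt0 ?pi_gt0 //.
rewrite sqrtr_gt0 SE !det_mulmx mulrAC -det_mulmx (mulmx1C QQ) det1 mul1r.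
rewrite det_diag; apply: prodr_gt0 => i _.
exact: (posdef_diag_gt0 i hS QQ SE).
Qed.

Lemma trace_mul_le (R : realType) n (D S Q : 'M[R]_n) (d : 'rV[R]_n) (s : R) :
  sym_possemidef D -> Q^T *m Q = 1%:M -> S = Q *m diag_mx d *m Q^T ->
  (forall i, d 0 i <= s) -> \tr (D *m S) <= s * \tr D.
Proof.
move=> [_ Dpos] QQ SE ds.
rewrite SE !mulmxA mxtrace_mulC !mulmxA tr_mul_diag.
have -> : \tr D = \tr (Q^T *m D *m Q).
  by rewrite mxtrace_mulC mulmxA (mulmx1C QQ) mul1mx.
rewrite mulr_sumr; apply: ler_sum => i _.
by rewrite mulrC ler_wpM2r // quad_form_col.
Qed.

Lemma rho_le_max (R : realType) n (A D S Q : 'M[R]_n) (d : 'rV[R]_n) (s : R) :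
  (0 < n)%N -> sym_posdef S ->
  Q^T *m Q = 1%:M -> S = Q *m diag_mx d *m Q^T ->
  (forall i, d 0 i <= s) -> 0 <= s -> admissible S (A, D) -> rho A <= s.
Proof.
move=> n0 hS QQ SE ds s0 [/= Dpos trD OU0].
have trA : - \tr A = \tr (D *m S).
  (* At the origin only the two traces remain. *)
  have := OU0 0; rewrite OU_dual_psi; last exact/symmetricmxP/hS.1.
  move/eqP; rewrite mulf_eq0 gt_eqF ?psi_infty_gt0 //=.
  rewrite /quad_form !mulmx0 !mxE add0r addr0 => /eqP h; lra.
have n0' : 0 < n%:R :> R by rewrite ltr0n.
rewrite -(ler_pM2r n0') (le_trans (rho_le_trace A n0)) // trA.
by rewrite (le_trans (trace_mul_le Dpos QQ SE ds)) // ler_wpM2l.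
Qed.

(** * An optimal drift *)

(** The antisymmetric matrix with [1] below the diagonal and [-1] above. *)
Definition sgn_mx (R : pzRingType) n : 'M[R]_n :=
  \matrix_(i, j) ((j < i)%N%:R - (i < j)%N%:R).

Lemma tr_sgn_mx (R : pzRingType) n : (sgn_mx R n)^T = - sgn_mx R n.
Proof. by apply/matrixP => i j; rewrite !mxE opprB. Qed.

Lemma sgn_mxD1_trig (R : comPzRingType) n (s : R) :
  is_trig_mx (s *: (const_mx 1 + sgn_mx R n)).
Proof.
apply/is_trig_mxP => i j ij; rewrite !mxE ij ltnNge (ltnW ij) /=.
by rewrite sub0r subrr mulr0.
Qed.

Lemma tr_mulZ (R : comPzRingType) m n (c : R) (x : 'M[R]_(m, n)) :
  (c *: x)^T *m (c *: x) = c ^+ 2 *: (x^T *m x).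
Proof.
by rewrite -scalemxAr [(c *: x)^T]linearZ -scalemxAl scalerA expr2.
Qed.

(** For each eigenvalue [d_k] of [S] there is an [S]-orthonormal basis, given by
    the columns of [P], whose sum [u] is an eigenvector for [d_k]; only the
    length of [u] is recorded. The reflection [H] recombines the columns of
    [Q diag(1 / sqrt d)] so that their sum is a multiple of the [k]-th one. *)
Lemma congr_to1_sum_columns (R : realType) n (S Q : 'M[R]_n) (d : 'rV[R]_n) k :
  Q^T *m Q = 1%:M -> S = Q *m diag_mx d *m Q^T -> (forall i, 0 < d 0 i) ->
  exists P : 'M[R]_n, P^T *m S *m P = 1%:M /\
    let u : 'cV[R]_n := P *m const_mx 1 in
    d 0 k * (u^T *m u) 0 0 = n%:R.
Proof.
move=> QQ SE d0.
pose r : 'rV[R]_n := \row_i (Num.sqrt (d 0 i))^-1.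
have rd i : r 0 i * r 0 i * d 0 i = 1.
  by rewrite mxE -expr2 exprVn sqr_sqrtr ?ltW // mulVf // gt_eqF.
pose one : 'cV[R]_n := const_mx 1.
pose y : 'cV[R]_n := Num.sqrt n%:R *: delta_mx k 0.
have yy : (one^T *m one) 0 0 = (y^T *m y) 0 0.
  rewrite /y tr_mulZ trmx_delta mul_delta_mx sqr_sqrtr ?ler0n //.
  rewrite mxE [RHS]mxE mxE !eqxx mulr1.
  under eq_bigr do rewrite !mxE mulr1.
  by rewrite sumr_const card_ord.
have [H [Hsym HH Hy]] := householder yy.
exists (Q *m diag_mx r *m H); split.
  rewrite !trmx_mul Hsym tr_diag_mx SE !mulmxA.
  rewrite -(mulmxA _ Q^T Q) QQ mulmx1 -(mulmxA _ Q^T Q) QQ mulmx1.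
  rewrite -(mulmxA H) mulmx_diag -(mulmxA H) mulmx_diag.
  rewrite (_ : diag_mx _ = 1%:M) ?mulmx1 //.
  rewrite -diag_const_mx; congr diag_mx; apply/rowP => i; rewrite !mxE.
  by have := rd i; rewrite mxE mulrAC.
rewrite /= -!mulmxA -/one Hy /y -2!scalemxAr tr_mulZ sqr_sqrtr ?ler0n //.
rewrite !trmx_mul tr_diag_mx !mulmxA -(mulmxA _ Q^T Q) QQ mulmx1.
rewrite trmx_delta -colE -!mulmxA -rowE mulmx_diag mxE.
rewrite !mxE eqxx mulr1n mulrCA.
by have := rd k; rewrite !mxE mulrC => ->; rewrite mulr1.
Qed.

Theorem theorem1 (R : realType) (N : nat) (hN : (1 <= N)%N)
    (S : 'M[R]_N) (hS : sym_posdef S) :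
  exists2 m : R,
    is_max [set rho AD.1 | AD in admissible S] m &
    is_max (spectrum S) (m%:C).
Proof.
have Ssym := symmetricmxP _ hS.1.
have [Q [d [QQ SE]]] := real_spectral Ssym.
have d0 i : 0 < d 0 i := posdef_diag_gt0 i hS QQ SE.
pose k := [arg max_(i > Ordinal hN) d 0 i]%O.
have dk i : d 0 i <= d 0 k by rewrite /k; case: arg_maxP => // j _; apply.
exists (d 0 k); split.
- have [P [PSP Pone]] := congr_to1_sum_columns k QQ SE d0.
  set s := d 0 k in Pone *.
  pose u : 'cV[R]_N := P *m const_mx 1.
  pose D := s *: (u *m u^T); pose J := s *: (P *m sgn_mx R N *m P^T).
  have uu : u *m u^T = P *m const_mx 1 *m P^T.
    rewrite /u trmx_mul trmx_const !mulmxA -(mulmxA P); congr (_ *m _ *m _).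
    by apply/matrixP => i j; rewrite !mxE big_ord1 !mxE mulr1.
  have Dsym : D^T = D by rewrite /D linearZ /= trmx_mul trmxK.
  have Jskew : J^T = - J.
    rewrite /J linearZ /= !trmx_mul trmxK tr_sgn_mx mulNmx mulmxN mulmxA.
    by rewrite scalerN.
  exists (- ((D + J) *m S), D).
    split=> /=.
    + split; first exact/symmetricmxP.
      move=> x; rewrite /quad_form /D -scalemxAr -scalemxAl mxE.
      apply: mulr_ge0; first by rewrite ltW // d0.
      have -> : x^T *m (u *m u^T) *m x = (u^T *m x)^T *m (u^T *m x).
        by rewrite [(u^T *m x)^T]trmx_mul trmxK !mulmxA.
      exact: normsq_ge0.
    + by rewrite /D linearZ /= mxtrace_mulC trace_mx11 Pone.
    + by move=> x; apply: OU_dual_skew.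
  (* D + J = P T P^T with T triangular, and P^T S is the inverse of P. *)
  apply: rho_spectrum1.
  have -> : - ((D + J) *m S) =
      P *m (- s *: (const_mx 1 + sgn_mx R N)) *m (P^T *m S).
    rewrite /D /J uu -scalerDr -mulmxDl -mulmxDr -scalemxAr -!scalemxAl.
    by rewrite scaleNr !mulmxA.
  rewrite spectrum_trig //; last exact: sgn_mxD1_trig.
  have diagE i : (- s *: (const_mx 1 + sgn_mx R N)) i i = - s.
    by rewrite !mxE ltnn subrr addr0 mulr1.
  apply/seteqP; split => [_ [i _ <-]|_ ->]; first by rewrite diagE.
  by exists k => //; rewrite diagE.
- move=> _ [[A D] AD <-].
  exact: (rho_le_max hN hS QQ SE dk (ltW (d0 k)) AD).
- rewrite SE (spectrum_trig QQ (diag_mx_is_trig d)).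
  by exists k; rewrite // mxE eqxx mulr1n.
- rewrite SE (spectrum_trig QQ (diag_mx_is_trig d)) => _ [i _ <-].
  by rewrite mxE eqxx mulr1n lecR.
Qed.
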